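(* Let $1\le p\le q\le\infty$ and $r=2/(1/q-1/p+1)$. Then $\mathfrak{S}_r$ embeds contractively into $CB(H_{\min},H(\Phi_p,\Phi_q))$: every $A\in\mathfrak{S}_r$, regarded as a linear map $H\to H$, satisfies $\|A\|_{CB(H_{\min},H(\Phi_p,\Phi_q))}\le\|A\|_r$.
   Context: $H$ is a separable infinite-dimensional Hilbert space with orthonormal basis $(\xi_i)$. $\Phi_p$ is the $\ell_p$-norm, $\mathfrak{S}_p$ the Schatten class with norm $\|\cdot\|_p$. For finite $T=\sum_i\xi_i\otimes T_i\in H\otimes M_n$, $\rho_T(x)=\sum_iT_ixT_i^*$ and $\|T\|_{\Phi_p,\Phi_q}=\|\rho_T:\mathfrak{S}_p(\mathbb{C}^n)\to\mathfrak{S}_q(\mathbb{C}^n)\|^{1/2}$; $H(\Phi_p,\Phi_q)$ is $H$ with these matrix norms on $M_n(H)\cong H\otimes M_n$. $H_{\min}$ is $H$ with matrix norms $\|\sum_{i=1}^m\xi_i\otimes T_i\|_{\min}=\sup\{\|\sum_iv_iT_i\|:v\in\ell_2^m,\|v\|=1\}$. For linear $u$ between spaces with matrix norms, $\|u\|_{cb}=\sup_n\|\mathrm{id}_{M_n}\otimes u\|$, and $CB(E,F)$ is the space of $u$ with finite cb-norm. *)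

(* Defs.v *)
From HB Require Import structures.
From mathcomp Require Import all_boot all_order all_algebra.
From mathcomp Require Import complex.
From mathcomp Require Import all_classical all_reals all_analysis.
Set Implicit Arguments. Unset Strict Implicit. Unset Printing Implicit Defensive.
Import Order.TTheory GRing.Theory Num.Theory.
Local Open Scope classical_set_scope.
Local Open Scope ring_scope.

Section Defs.
Variable R : realType.
Local Notation C := (R[i]).

Definition cabs2 (z : C) : R := complex.Re z ^+ 2 + complex.Im z ^+ 2.
Definition cconj (z : C) : C := Complex (complex.Re z) (- complex.Im z).

Definition vnorm m (x : 'cV[C]_m) : R := Num.sqrt (\sum_i cabs2 (x i 0)).

Definition opn k m (M : 'M[C]_(k, m)) : R :=
  sup [set vnorm (M *m x) | x in [set x : 'cV[C]_m | vnorm x <= 1]].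

Definition adj n (M : 'M[C]_n) : 'M[C]_n := (map_mx cconj M)^T.

Definition sing n (k : nat) (M : 'M[C]_n) : R :=
  inf [set opn (M - F) | F in [set F : 'M[C]_n | (\rank F <= k)%N]].

Definition schatten n (p : \bar R) (M : 'M[C]_n) : R :=
  match p with
  | x%:E => powR (\sum_(k < n) powR (sing k M) x) x^-1
  | _ => opn M
  end.

(* rho_T(x) = sum_i T_i x T_i^*  for T = sum_i xi_i (x) T_i *)
Definition rho n N (T : 'I_N -> 'M[C]_n) (x : 'M[C]_n) : 'M[C]_n :=
  \sum_i (T i *m x *m adj (T i)).

Definition norm_pq (p q : \bar R) n N (T : 'I_N -> 'M[C]_n) : R :=
  Num.sqrt (sup [set schatten q (rho T x) |
                 x in [set x : 'M[C]_n | schatten p x <= 1]]).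

Definition norm_min n m (T : 'I_m -> 'M[C]_n) : R :=
  sup [set opn (\sum_i (v i *: T i)) |
       v in [set v : 'I_m -> C | \sum_i cabs2 (v i) = 1]].

(* A bounded (or not) linear map on H = l_2(N) is given by its matrix
   a i j = <A xi_j, xi_i> in the orthonormal basis (xi_i). *)

(* (id (x) A)(sum_{j<m} xi_j (x) T_j) = sum_i xi_i (x) (sum_{j<m} a i j T_j);
   its truncation to the first N basis vectors: *)
Definition applyT n m (a : nat -> nat -> C) (T : 'I_m -> 'M[C]_n) N
  : 'I_N -> 'M[C]_n := fun i => \sum_(j < m) a i j *: T j.

(* H(Phi_p,Phi_q)-norm of (id (x) A) T, as the supremum of the norms of its
   finite truncations *)
Definition norm_pq_applied (p q : \bar R) n m (a : nat -> nat -> C)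
  (T : 'I_m -> 'M[C]_n) : \bar R :=
  ereal_sup [set (norm_pq p q (@applyT n m a T N))%:E | N in [set: nat]].

Definition cbnorm (p q : \bar R) (a : nat -> nat -> C) : \bar R :=
  ereal_sup [set y | exists n m (T : 'I_m -> 'M[C]_n),
                       norm_min T <= 1 /\ y = norm_pq_applied p q a T].

(* operator norm on l_2(N) of the matrix a (+oo if unbounded) *)
Definition opnormA (a : nat -> nat -> C) : \bar R :=
  ereal_sup [set y | exists N m (x : 'cV[C]_m), vnorm x <= 1 /\
     y = (vnorm (\col_(i < N) \sum_(j < m) a i j * x j 0))%:E].

Definition finrank (k : nat) (f : nat -> nat -> C) : Prop :=
  exists (u v : 'I_k -> nat -> C), forall i j, f i j = \sum_(l < k) u l i * v l j.

Definition approx (k : nat) (a : nat -> nat -> C) : \bar R :=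
  ereal_inf [set y | exists f, finrank k f /\
                       y = opnormA (fun i j => a i j - f i j)].

(* Schatten r-norm ||A||_r = ||(s_k(A))_k||_{l_r} (+oo if A is not in S_r);
   r = +oo : operator norm *)
Definition schattenA (r : \bar R) (a : nat -> nat -> C) : \bar R :=
  match r with
  | x%:E => poweR (\sum_(0 <= k <oo) poweR (approx k a) x)%E x^-1
  | _ => opnormA a
  end.

Definition einv (p : \bar R) : R := if p is x%:E then x^-1 else 0.

Definition rexp (p q : \bar R) : \bar R :=
  let d := einv q - einv p + 1 in
  if d == 0 then +oo%E else (2 / d)%:E.

End Defs.

(* Main.v *)
Require Import Defs.
From HB Require Import structures.
From mathcomp Require Import all_boot all_order all_algebra.
From mathcomp Require Import complex.
From mathcomp Require Import all_classical all_reals all_analysis.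
From mathcomp Require Import perm spectral sesquilinear ring lra zify.
Import Order.TTheory GRing.Theory Num.Theory.
Local Open Scope ring_scope.
Set Implicit Arguments. Unset Strict Implicit. Unset Printing Implicit Defensive.
Local Open Scope sesquilinear_scope.
Local Notation "x %:C" := (real_complex _ x) : ring_scope.

(** Let B be a finite truncation of A with B^* B = V diag(s_l^2) V^*. Rotating T by V
    gives a family W, still in the unit ball of the min norm, with
    rho(x) = sum_l s_l^2 W_l x W_l^*. Expanding x and rho(x) by their singular value
    decompositions, the singular values of rho(x) satisfy
    t_l <= sum_(i, k) s_i^2 x_k c_(i,k,l), where c >= 0 has all its one-index sums at
    most 1: c_(i,k,l) averages squared moduli of entries of contractions H^* W_i E and
    G^* W_i F. A trilinear Young inequality with exponents r/2, p and q', for which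
    2/r + 1/p + 1/q' = 2, then bounds ||rho||_(p -> q) by ||s||_r^2, so interpolation
    is not needed. The singular values of B are at most the approximation numbers
    of A. *)

(** * Squared moduli, adjoints and contractions of complex matrices *)

Section Complex.
Variable R : realType.
Local Notation C := R[i].

Lemma cconjE (z : C) : cconj z = z^*. Proof. by case: z. Qed.

Lemma mulCJ (z : C) : z * z^* = (cabs2 z)%:C.
Proof.
case: z => a b; apply/eqP; rewrite eq_complex /cabs2 /=.
by apply/andP; split; apply/eqP; ring.
Qed.

Lemma cabs2_ge0 (z : C) : 0 <= cabs2 z.
Proof. by rewrite addr_ge0 ?sqr_ge0. Qed.

Lemma cabs2M (z w : C) : cabs2 (z * w) = cabs2 z * cabs2 w.
Proof. by case: z w => a b [c d]; rewrite /cabs2 /=; ring. Qed.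

Lemma cabs2J (z : C) : cabs2 z^* = cabs2 z.
Proof. by case: z => a b; rewrite /cabs2 /= sqrrN. Qed.

Lemma cabs2_real (x : R) : cabs2 x%:C = x ^+ 2.
Proof. by rewrite /cabs2 /= expr0n addr0. Qed.

Lemma cabs2_eq0 (z : C) : cabs2 z = 0 -> z = 0.
Proof.
case: z => a b /eqP; rewrite /cabs2 /= paddr_eq0 ?sqr_ge0// !sqrf_eq0.
by case/andP=> /eqP -> /eqP ->.
Qed.

Lemma Re_sum I (r : seq I) (P : pred I) (F : I -> C) :
  complex.Re (\sum_(i <- r | P i) F i) = \sum_(i <- r | P i) complex.Re (F i).
Proof. by apply: (big_morph (@complex.Re R)) => // -[a b] [c d]. Qed.

Lemma Re_realM (x : R) (z : C) : complex.Re (x%:C * z) = x * complex.Re z.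
Proof. by case: z => a b; rewrite /= mul0r subr0. Qed.

Lemma conj_realC (x : R) : x%:C^* = x%:C.
Proof. by rewrite -[LHS]/(conjc _) conjc_real. Qed.

Lemma Re_mulJ_le (z w : C) : complex.Re (z * w^*) <= (cabs2 z + cabs2 w) / 2.
Proof.
case: z w => a b [c d]; rewrite -cconjE /cabs2 /=.
by have := sqr_ge0 (a - c); have := sqr_ge0 (b - d); nra.
Qed.

Lemma ctM m n k (A : 'M[C]_(m, n)) (B : 'M[C]_(n, k)) :
  (A *m B)^t* = B^t* *m A^t*.
Proof. by rewrite trmx_mul map_mxM. Qed.

Lemma adjE n (A : 'M[C]_n) : adj A = A^t*.
Proof. by apply/matrixP => i j; rewrite !mxE cconjE. Qed.

Lemma ctZ m n (c : C) (A : 'M[C]_(m, n)) : (c *: A)^t* = c^* *: A^t*.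
Proof. by apply/matrixP => i j; rewrite !mxE rmorphM. Qed.

Lemma ct_sum I (r : seq I) m n (A : I -> 'M[C]_(m, n)) :
  (\sum_(i <- r) A i)^t* = \sum_(i <- r) (A i)^t*.
Proof.
apply/matrixP => i j; rewrite !mxE !summxE rmorph_sum.
by apply: eq_bigr => k _; rewrite !mxE.
Qed.

Definition sqnorm m (x : 'cV[C]_m) : R := \sum_i cabs2 (x i 0).

Lemma vnormE m (x : 'cV[C]_m) : vnorm x = Num.sqrt (sqnorm x).
Proof. by []. Qed.

Lemma sqnorm_ge0 m (x : 'cV[C]_m) : 0 <= sqnorm x.
Proof. by rewrite sumr_ge0// => i _; exact: cabs2_ge0. Qed.

Lemma vnorm_ge0 m (x : 'cV[C]_m) : 0 <= vnorm x.
Proof. exact: sqrtr_ge0. Qed.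

Lemma vnorm_sqr m (x : 'cV[C]_m) : vnorm x ^+ 2 = sqnorm x.
Proof. by rewrite sqr_sqrtr ?sqnorm_ge0. Qed.

Lemma vnorm_le m (x : 'cV[C]_m) (c : R) : 0 <= c ->
  (vnorm x <= c) = (sqnorm x <= c ^+ 2).
Proof. by move=> c0; rewrite -vnorm_sqr ler_pXn2r ?nnegrE ?vnorm_ge0. Qed.

Lemma sqnorm0 m : sqnorm (0 : 'cV[C]_m) = 0.
Proof. by rewrite /sqnorm big1// => i _; rewrite mxE /cabs2 /= expr0n addr0. Qed.

Lemma sqnorm_eq0 m (x : 'cV[C]_m) : sqnorm x = 0 -> x = 0.
Proof.
move/eqP; rewrite psumr_eq0 => [/allP h|i _]; last exact: cabs2_ge0.
apply/matrixP => i j; rewrite ord1 mxE; apply/cabs2_eq0/eqP.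
by apply: h; rewrite mem_index_enum.
Qed.

Lemma sqnormZ m (c : C) (x : 'cV[C]_m) : sqnorm (c *: x) = cabs2 c * sqnorm x.
Proof. by rewrite /sqnorm mulr_sumr; apply: eq_bigr => i _; rewrite mxE cabs2M. Qed.

Lemma gram_colE m n (A : 'M[C]_(m, n)) j :
  (A^t* *m A) j j = (sqnorm (col j A))%:C.
Proof.
rewrite mxE rmorph_sum; apply: eq_bigr => i _.
by rewrite !mxE mulrC mulCJ.
Qed.

Lemma sqnormE m (x : 'cV[C]_m) : sqnorm x = complex.Re ((x^t* *m x) 0 0).
Proof. by rewrite gram_colE /= col_id. Qed.

Lemma sqnorm_mul m n (A : 'M[C]_(m, n)) x :
  sqnorm (A *m x) = complex.Re ((x^t* *m (A^t* *m A) *m x) 0 0).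
Proof. by rewrite sqnormE ctM !mulmxA. Qed.

Definition isom_mx m n (A : 'M[C]_(m, n)) := A^t* *m A = 1%:M.

(** Stated on vectors, so that no supremum has to be handled. *)
Definition contr m n (A : 'M[C]_(m, n)) :=
  forall x, sqnorm (A *m x) <= sqnorm x.

Lemma sqnorm_isom m n (A : 'M[C]_(m, n)) x : isom_mx A -> sqnorm (A *m x) = sqnorm x.
Proof. by move=> AA; rewrite sqnorm_mul AA mulmx1 -sqnormE. Qed.

Lemma isom_contr m n (A : 'M[C]_(m, n)) : isom_mx A -> contr A.
Proof. by move=> AA x; rewrite sqnorm_isom. Qed.

Lemma contrM m n k (A : 'M[C]_(m, n)) (B : 'M[C]_(n, k)) :
  contr A -> contr B -> contr (A *m B).
Proof. by move=> cA cB x; rewrite -mulmxA (le_trans (cA _)). Qed.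

(** This is |x - y|^2 >= 0 expanded, coordinate by coordinate. *)
Lemma sqnormB_ge m (x y : 'cV[C]_m) :
  2 * complex.Re ((x^t* *m y) 0 0) <= sqnorm x + sqnorm y.
Proof.
rewrite mxE Re_sum mulr_sumr -big_split ler_sum// => i _.
rewrite !mxE [(x i 0)^* * _]mulrC; move: (Re_mulJ_le (y i 0) (x i 0)) => /=; lra.
Qed.

(* If A is a contraction, so is A^*: expand 0 <= |x - A A^* x|^2 and bound
   |A A^* x| by |A^* x|. *)
Lemma contr_ct m n (A : 'M[C]_(m, n)) : contr A -> contr (A^t*).
Proof.
move=> cA x; have h1 := cA (A^t* *m x).
have := sqnormB_ge x (A *m (A^t* *m x)).
have -> : x^t* *m (A *m (A^t* *m x)) = (A^t* *m x)^t* *m (A^t* *m x).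
  by rewrite ctM trmxCK !mulmxA.
by rewrite -sqnormE; lra.
Qed.

Lemma contr_col m n (A : 'M[C]_(m, n)) k : contr A -> \sum_l cabs2 (A l k) <= 1.
Proof.
move=> /(_ (delta_mx k 0)).
rewrite -colE => h; apply: le_trans (le_trans h _).
  by rewrite /sqnorm; under [leRHS]eq_bigr do rewrite mxE.
rewrite /sqnorm (bigD1 k)//= big1 => [|i ik].
  by rewrite mxE !eqxx cabs2_real expr1n addr0.
by rewrite mxE (negbTE ik) cabs2_real expr0n.
Qed.

Lemma contr_row m n (A : 'M[C]_(m, n)) l : contr A -> \sum_k cabs2 (A l k) <= 1.
Proof.
move=> /contr_ct/(@contr_col _ _ _ l); apply: le_trans.
by apply: ler_sum => k _; rewrite !mxE cabs2J.
Qed.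

Lemma contr_entry m n (A : 'M[C]_(m, n)) l k : contr A -> cabs2 (A l k) <= 1.
Proof.
move=> /(@contr_col _ _ _ k); apply: le_trans.
by rewrite (bigD1 l)//= lerDl sumr_ge0// => i _; exact: cabs2_ge0.
Qed.

(** Cauchy-Schwarz, read off from [contr_ct]: the column of conjugates of [u] is a contraction from
    C^1, hence so is its adjoint, the row [u]. *)
Lemma cabs2_sum_le m (u v : 'I_m -> C) : \sum_i cabs2 (u i) <= 1 ->
  cabs2 (\sum_i u i * v i) <= \sum_i cabs2 (v i).
Proof.
move=> u1; pose x : 'cV[C]_m := \col_i (u i)^*.
have cx : contr x.
  move=> y; rewrite [y]mx11_scalar mul_mx_scalar sqnormZ.
  rewrite {2}/sqnorm big_ord1 mxE eqxx mulr1n ler_piMr ?cabs2_ge0//.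
  by apply: le_trans u1; apply: ler_sum => i _; rewrite mxE cabs2J.
have := contr_ct cx (\col_i v i).
rewrite /sqnorm big_ord1 mxE; congr (cabs2 _ <= _); apply: eq_bigr => i _;
  by rewrite !mxE ?conjCK.
Qed.

(** Cauchy-Schwarz in each row. It serves to bound the sets under the suprema [opn] and [norm_min];
    the [sup] of an unbounded set is only a default value. *)
Lemma sqnorm_bound m n (A : 'M[C]_(m, n)) x : sqnorm x <= 1 ->
  sqnorm (A *m x) <= \sum_i \sum_j cabs2 (A i j).
Proof.
move=> x1; apply: ler_sum => i _; rewrite mxE.
under eq_bigr do rewrite mulrC.
exact: cabs2_sum_le.
Qed.
End Complex.

(** * Diagonalisation of Gram matrices *)

Section SVD.
Variable R : realType.
Local Notation C := R[i].

Definition real_diag m (s : 'I_m -> R) : 'M[C]_m := diag_mx (\row_j (s j)%:C).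

Lemma mul_real_diag m n (A : 'M[C]_(n, m)) (s : 'I_m -> R) i j :
  (A *m real_diag s) i j = (s j)%:C * A i j.
Proof. by rewrite mul_mx_diag !mxE mulrC. Qed.

Lemma real_diag_ct m (s : 'I_m -> R) : (real_diag s)^t* = real_diag s.
Proof.
apply/matrixP => i j; rewrite !mxE eq_sym; case: eqVneq => [->|_].
  by rewrite mulr1n conj_realC.
by rewrite mulr0n conjC0.
Qed.

Lemma sqnorm_real_diag m (s : 'I_m -> R) x :
  sqnorm (real_diag s *m x) = \sum_i s i ^+ 2 * cabs2 (x i 0).
Proof.
apply: eq_bigr => i _.
by rewrite mul_diag_mx !mxE cabs2M cabs2_real.
Qed.

Lemma real_diag_sqr m (s : 'I_m -> R) :
  real_diag (fun j => s j ^+ 2) = real_diag s *m real_diag s.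
Proof.
apply/matrixP => i j; rewrite mul_real_diag !mxE; case: eqVneq => [->|_].
  by rewrite !mulr1n -rmorphM expr2.
by rewrite !mulr0n mulr0.
Qed.

(** The spectral theorem for the Hermitian matrix M^* M, then a permutation of the eigenvectors. The
    decreasing order is what ties [s l] to approximation by rank [l]. *)
Lemma gram_diag N m (M : 'M[C]_(N, m)) : exists (V : 'M[C]_m) (s : 'I_m -> R),
  [/\ isom_mx V, forall j, 0 <= s j,
      forall k l : 'I_m, (k <= l)%N -> s l <= s k &
      (M *m V)^t* *m (M *m V) = real_diag (fun j => s j ^+ 2)].
Proof.
pose A := M^t* *m M; pose P := spectralmx A.
have AA : A^t* = A by rewrite /A ctM trmxCK.
have PU : P \is unitarymx by exact: spectral_unitarymx.
have /orthomx_spectralP : A \is normalmx by apply/normalmxP; rewrite AA.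
rewrite -/P invmx_unitary //; move: (spectral_diag A) => D AE.
have VV : isom_mx (P^t*) by rewrite /isom_mx trmxCK; apply/unitarymxP.
have DE : (M *m P^t*)^t* *m (M *m P^t*) = diag_mx D.
  rewrite ctM trmxCK !mulmxA -(mulmxA P) -/A AE !mulmxA.
  by rewrite (unitarymxP PU) mul1mx -mulmxA (unitarymxP PU) mulmx1.
(* An eigenvalue is the squared norm of a column of M P^*, hence real and nonnegative. *)
pose d j := sqnorm (col j (M *m P^t*)).
have dE : diag_mx D = real_diag d.
  apply/matrixP => i j; rewrite !mxE; case: eqVneq => [->|_]//.
  rewrite !mulr1n; have /matrixP/(_ j j) := DE.
  by rewrite gram_colE mxE eqxx mulr1n => <-.
have [p pE] : exists p : {perm 'I_m}, forall k l : 'I_m, (k <= l)%N -> d (p l) <= d (p k).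
  pose ge := [rel x y : R | y <= x].
  pose t : m.-tuple R := [tuple d i | i < m].
  have szt : size (sort ge t) == m by rewrite size_sort size_tuple.
  have /tuple_permP[p pE] : perm_eq (Tuple szt) t by rewrite perm_sort.
  exists p => k l kl.
  have nE (j : 'I_m) : d (p j) = nth 0 (sort ge t) j.
    rewrite -[sort ge t]/(val (Tuple szt)) -tnth_nth.
    rewrite (_ : Tuple szt = [tuple tnth t (p i) | i < m]); last exact: val_inj.
    by rewrite !tnth_mktuple.
  rewrite !nE; apply: (@sorted_leq_nth _ ge) => //.
  - by move=> x y z /= h1 h2; apply: le_trans h1.
  - by move=> x /=.
  - by apply: sort_sorted => x y /=; exact: le_total.
  - by rewrite inE (eqP szt).
  - by rewrite inE (eqP szt).
exists (col_perm p (P^t*)), (fun j => Num.sqrt (d (p j))); split.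
- apply/matrixP => i j; have /matrixP/(_ (p i) (p j)) := VV.
  rewrite !mxE (inj_eq perm_inj) => <-.
  by apply: eq_bigr => k _; rewrite !mxE.
- by move=> j; exact: sqrtr_ge0.
- by move=> k l /pE h; rewrite ler_wsqrtr.
- apply/matrixP => i j.
  have /matrixP/(_ (p i) (p j)) := DE.
  rewrite dE !mxE (inj_eq perm_inj) => h.
  rewrite sqr_sqrtr ?sqnorm_ge0// -h; apply: eq_bigr => k _.
  by rewrite !mxE; congr (_^* * _); apply: eq_bigr => l _; rewrite !mxE.
Qed.

(** * Consequences of a fixed, ordered diagonalisation of M^* M *)

Section Gram.
Context {N m : nat} {M : 'M[C]_(N, m)} {V : 'M[C]_m} {s : 'I_m -> R}.
Hypothesis VV : isom_mx V.
Hypothesis s0 : forall j, 0 <= s j.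
Hypothesis sle : forall k l : 'I_m, (k <= l)%N -> s l <= s k.
Hypothesis gram : (M *m V)^t* *m (M *m V) = real_diag (fun j => s j ^+ 2).

Lemma sqnorm_gram x : sqnorm (M *m V *m x) = \sum_j s j ^+ 2 * cabs2 (x j 0).
Proof.
by rewrite sqnorm_mul gram -[RHS]sqnorm_real_diag sqnorm_mul real_diag_ct real_diag_sqr.
Qed.

(** The last clause gives each singular value as a diagonal entry; this is how a single singular
    value of rho(x) is expanded later. *)
Lemma polar : exists E : 'M[C]_(N, m),
  [/\ contr E, M *m V = E *m real_diag s &
      forall l, (E^t* *m (M *m V)) l l = (s l)%:C].
Proof.
(* As [0^-1 = 0], the columns with [s j = 0] become zero; nothing is lost, since column j of M V has
   squared norm [s j ^+ 2]. *)
pose E := M *m V *m real_diag (fun j => (s j)^-1).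
have colV j : sqnorm (col j (M *m V)) = s j ^+ 2.
  by apply: (@complexI R); rewrite -gram_colE gram !mxE eqxx mulr1n.
exists E; split.
- move=> x; rewrite /E -mulmxA sqnorm_gram; apply: ler_sum => j _.
  rewrite mul_diag_mx !mxE cabs2M cabs2_real mulrA -exprMn.
  have [->|sj] := eqVneq (s j) 0; first by rewrite mul0r expr0n mul0r cabs2_ge0.
  by rewrite divff// expr1n mul1r.
- apply/matrixP => i j; rewrite !mul_real_diag mulrA -rmorphM.
  have [sj|sj] := eqVneq (s j) 0; last by rewrite divff// rmorph1 mul1r.
  have /sqnorm_eq0 /matrixP/(_ i 0) : sqnorm (col j (M *m V)) = 0.
    by rewrite colV sj expr0n.
  by rewrite !mxE => ->; rewrite mulr0.
- move=> l; rewrite ctM real_diag_ct -mulmxA gram.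
  rewrite mul_real_diag !mxE eqxx mulr1n -rmorphM; congr (_%:C).
  have [->|sj] := eqVneq (s l) 0; first by rewrite expr0n mul0r.
  by rewrite expr2 mulfK.
Qed.

(* Courant-Fischer: a matrix of rank at most l kills a unit vector in the span
   of the first l + 1 right singular vectors. *)
Lemma rank_kernel_vector (F : 'M[C]_(N, m)) (l : 'I_m) : (\rank F <= l)%N ->
  exists x, [/\ sqnorm x = 1, F *m x = 0 & s l <= vnorm (M *m x)].
Proof.
(* A vector killed by [G] is killed by F V and has no coordinate beyond index [l]. The rank of [G]
   is at most l + (m - l - 1) < m, so a nonzero one exists. *)
move=> rF; pose G := col_mx (F *m V) (copid_mx l.+1 : 'M[C]_m).
have : kermx G^T != 0.
  rewrite kermx_eq0 /row_free mxrank_tr -addsmxE neq_ltn; apply/orP; left.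
  apply: leq_ltn_trans (mxrank_adds_leqif _ _) _.
  rewrite rank_copid_mx//; have := mxrankM_maxl F V; have := ltn_ord l.
  by move: (\rank _) (\rank _) rF => a b; lia.
case/rowV0Pn => u /sub_kermxP uG u0.
have Gu : G *m u^T = 0 by apply: trmx_inj; rewrite trmx_mul trmxK uG trmx0.
move: Gu; rewrite mul_col_mx => /(congr1 (fun X => (usubmx X, dsubmx X))).
rewrite col_mxKu col_mxKd !linear0 => -[Fu cu].
have uj (j : 'I_m) : (l < j)%N -> u 0 j = 0.
  move=> lj; have : u^T = pid_mx l.+1 *m u^T.
    by apply/eqP; rewrite -subr_eq0 -{1}[u^T]mul1mx -mulmxBl -/(copid_mx _) cu.
  move=> /matrixP/(_ j 0); rewrite mxE => ->; rewrite mxE big1// => k _.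
  by rewrite !mxE ltnS leqNgt lj andbF mul0r.
have un : 0 < sqnorm u^T.
  rewrite lt_def sqnorm_ge0 andbT; apply: contra u0 => /eqP/sqnorm_eq0 h.
  by rewrite -[u]trmxK h trmx0.
pose c : C := ((Num.sqrt (sqnorm u^T))^-1)%:C.
have c1 : cabs2 c * sqnorm u^T = 1.
  by rewrite cabs2_real exprVn sqr_sqrtr ?ltW// mulVf// gt_eqF.
exists (c *: (V *m u^T)); split.
- by rewrite sqnormZ sqnorm_isom.
- by rewrite -scalemxAr mulmxA Fu scaler0.
(* Only coordinates j <= l survive, and there [s l <= s j]. *)
- rewrite -ler_sqr ?nnegrE ?vnorm_ge0// vnorm_sqr -scalemxAr mulmxA sqnormZ.
  rewrite sqnorm_gram -[leLHS]mulr1 -c1 mulrCA ler_wpM2l ?cabs2_ge0//.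
  rewrite mulr_sumr; apply: ler_sum => j _; have [lj|jl] := ltnP l j.
    by rewrite mxE uj// cabs2_real expr0n !mulr0.
  by rewrite ler_wpM2r ?cabs2_ge0// lerXn2r ?nnegrE// sle.
Qed.
End Gram.

(** * Operator norm, approximation numbers and singular value decomposition *)

Lemma isom_ctK m (V : 'M[C]_m) : isom_mx V -> V *m V^t* = 1%:M.
Proof. exact: mulmx1C. Qed.

Lemma opn_ge k m (M : 'M[C]_(k, m)) x : vnorm x <= 1 -> vnorm (M *m x) <= opn M.
Proof.
move=> x1; apply: ub_le_sup; last by exists x.
exists (Num.sqrt (\sum_i \sum_j cabs2 (M i j))) => _ [y /= y1 <-].
rewrite ler_wsqrtr//; apply: sqnorm_bound.
by move: y1; rewrite vnorm_le// expr1n.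
Qed.

Lemma opn_le k m (M : 'M[C]_(k, m)) c :
  (forall x, vnorm x <= 1 -> vnorm (M *m x) <= c) -> opn M <= c.
Proof.
move=> h; apply: ge_sup => [|_ [y /= y1 <-]]; last exact: h.
by exists (vnorm (M *m 0)), 0 => //=; rewrite vnormE sqnorm0 sqrtr0.
Qed.

Lemma opn_ge0 k m (M : 'M[C]_(k, m)) : 0 <= opn M.
Proof.
apply: (le_trans (vnorm_ge0 (M *m 0))); apply: opn_ge.
by rewrite vnormE sqnorm0 sqrtr0.
Qed.

Lemma opn_contr k m (M : 'M[C]_(k, m)) : opn M <= 1 -> contr M.
Proof.
move=> M1 x; have [x0|x0] := eqVneq (sqnorm x) 0.
  by rewrite (sqnorm_eq0 x0) mulmx0 !sqnorm0.
have xp : 0 < sqnorm x by rewrite lt_def x0 sqnorm_ge0.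
pose c : C := ((Num.sqrt (sqnorm x))^-1)%:C.
have c2 : cabs2 c = (sqnorm x)^-1.
  by rewrite cabs2_real exprVn sqr_sqrtr ?ltW.
have /opn_ge : vnorm (c *: x) <= 1 by rewrite vnorm_le// sqnormZ c2 mulVf// expr1n.
move=> /(_ _ M) /le_trans /(_ M1).
by rewrite vnorm_le// -scalemxAr sqnormZ c2 expr1n mulrC ler_pdivrMr// mul1r.
Qed.

Lemma sing_le n k (M F : 'M[C]_n) : (\rank F <= k)%N -> sing k M <= opn (M - F).
Proof.
move=> rF; apply: ge_inf; last by exists F.
by exists 0 => _ [G _ <-]; exact: opn_ge0.
Qed.

Lemma sing_ge n k (M : 'M[C]_n) c :
  (forall F : 'M[C]_n, (\rank F <= k)%N -> c <= opn (M - F)) -> c <= sing k M.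
Proof.
move=> h; apply: lb_le_inf => [|_ [F rF <-]]; last exact: h.
by exists (opn (M - 0)), 0 => //=; rewrite mxrank0.
Qed.

Lemma sing_ge0 n k (M : 'M[C]_n) : 0 <= sing k M.
Proof. by apply: sing_ge => F _; exact: opn_ge0. Qed.

Lemma sing_le_opn n k (M : 'M[C]_n) : sing k M <= opn M.
Proof. by rewrite -[M in leRHS]subr0; apply: sing_le; rewrite mxrank0. Qed.

(** The outer factors are contractions, so only the diagonal counts. Used for the tail of a
    truncated decomposition and for the operator norm when q = oo. *)
Lemma opn_factor n (M E V : 'M[C]_n) (s : 'I_n -> R) c : 0 <= c ->
  (forall j, `|s j| <= c) -> contr E -> isom_mx V -> M = E *m real_diag s *m V^t* ->
  opn M <= c.
Proof.
move=> c0 sc cE VV ->; apply: opn_le => x; rewrite !vnorm_le// expr1n => x1.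
rewrite -!mulmxA (le_trans (cE _))// sqnorm_real_diag.
have := le_trans (contr_ct (isom_contr VV) x) x1.
move=> /(ler_wpM2l (sqr_ge0 c)); rewrite mulr1; apply: le_trans.
rewrite mulr_sumr; apply: ler_sum => j _; rewrite ler_wpM2r ?cabs2_ge0//.
by rewrite -(real_normK (num_real (s j))) lerXn2r ?nnegrE.
Qed.

(* The columns of E at zero singular values are zero, so E is in general only a
   contraction and not unitary. *)
Lemma svd n (M : 'M[C]_n) : exists (E V : 'M[C]_n) (s : 'I_n -> R),
  [/\ contr E, isom_mx V, M = E *m real_diag s *m V^t*,
      forall l, (E^t* *m (M *m V)) l l = (s l)%:C &
      forall l, 0 <= s l /\ s l = sing l M].
Proof.
have [V [s [VV s0 sle gr]]] := gram_diag M.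
have [E [cE ME sE]] := polar gr.
have MV : M = E *m real_diag s *m V^t* by rewrite -ME -mulmxA isom_ctK// mulmx1.
exists E, V, s; split=> // l; split=> //; apply/le_anti/andP; split.
  (* Any F of rank at most l kills a unit vector x with |M x| >= [s l], so M - F has norm at least
     [s l]. *)
  apply: sing_ge => F /(rank_kernel_vector VV s0 sle gr)[x [x1 Fx /le_trans]]; apply.
  rewrite -[M *m x]subr0 -Fx -mulmxBl; apply: opn_ge.
  by rewrite vnorm_le// x1 expr1n.
(* Eckart-Young: keep the first [l] singular values; those left over are at most [s l]. *)
pose F := E *m real_diag s *m pid_mx l *m V^t*.
have rF : (\rank F <= l)%N.
  apply: leq_trans (mxrankM_maxl _ _) _; apply: leq_trans (mxrankM_maxr _ _) _.
  by rewrite rank_pid_mx// ltnW.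
apply: le_trans (sing_le M rF) _.
apply: (@opn_factor _ _ E V (fun j => if (j < l)%N then 0 else s j)) => //.
  by move=> j; case: ltnP => [_|lj]; rewrite ?normr0// ger0_norm// sle.
rewrite [in LHS]MV /F -mulmxBl; congr (_ *m _); rewrite -mulmxA -mulmxBr; congr (_ *m _).
apply/matrixP => i j; rewrite mul_diag_mx !mxE.
have [->|ij] := eqVneq i j; last first.
  by rewrite (negbTE (ij : i != j :> nat)) mulr0 mulr0n subrr.
rewrite eqxx !mulr1n.
by case: ltnP => _; rewrite ?mulr1 ?subrr ?mulr0 ?subr0.
Qed.
End SVD.

(** * Young-type inequalities and l_p duality for finite families *)

Section Young.
Variable R : realType.

(** From ln u <= u - 1. At u = 0 the power is 0, or 1 = exp 0 when [al] is 0. *)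
Lemma powR_le_expR (u al : R) : 0 <= u -> 0 <= al -> u `^ al <= expR (al * (u - 1)).
Proof.
move=> u0 al0; rewrite /powR; case: eqVneq => [->|un].
  case: eqVneq => [->|_]; last exact: expR_ge0.
  by rewrite mul0r expR0.
rewrite ler_expR ler_wpM2l// -{1}(subrK 1 u) addrC le_ln1Dx//.
by rewrite ltrBrDl subrr lt_def un.
Qed.

(** After division by the mean [s], the bounds of [powR_le_expR] for the three factors multiply to
    exp 0 = 1. *)
Lemma weighted_AMGM3 (u v w al be ga : R) : 0 <= u -> 0 <= v -> 0 <= w ->
  0 <= al -> 0 <= be -> 0 <= ga -> al + be + ga = 1 ->
  u `^ al * v `^ be * w `^ ga <= al * u + be * v + ga * w.
Proof.
move=> u0 v0 w0 al0 be0 ga0 abg; set s := al * u + be * v + ga * w.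
have s0 : 0 <= s by rewrite !addr_ge0// mulr_ge0.
(* If the mean is 0, some exponent is nonzero because they sum to 1; its base then vanishes, and so
   does the product. *)
have [s00|sn] := eqVneq s 0.
  have [] : al * u = 0 /\ be * v = 0 /\ ga * w = 0.
    have := mulr_ge0 al0 u0; have := mulr_ge0 be0 v0; have := mulr_ge0 ga0 w0.
    by rewrite /s in s00; move=> *; repeat split; lra.
  move=> /eqP + [/eqP + /eqP]; rewrite !mulf_eq0.
  have z (x e : R) : e != 0 -> x == 0 -> x `^ e = 0 by move=> e0 /eqP ->; rewrite powR0.
  have [ae|an] /= := eqVneq al 0; last by move=> /(z _ _ an) ->; rewrite !mul0r.
  have [bee|bn] /= := eqVneq be 0; last by move=> _ /(z _ _ bn) ->; rewrite mulr0 mul0r.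
  have [gae|gn] /= := eqVneq ga 0; last by move=> _ _ /(z _ _ gn) ->; rewrite mulr0.
  by move: abg; rewrite ae bee gae !addr0 => /eqP; rewrite eq_sym oner_eq0.
have sp : 0 < s by rewrite lt_def sn.
have scale (x e : R) : 0 <= x -> x `^ e = s `^ e * (x / s) `^ e.
  by move=> x0; rewrite -powRM ?divr_ge0// mulrC divfK.
rewrite (scale u)// (scale v)// (scale w)//.
have -> : s `^ al * (u / s) `^ al * (s `^ be * (v / s) `^ be) * (s `^ ga * (w / s) `^ ga) =
    s `^ (al + be + ga) * ((u / s) `^ al * (v / s) `^ be * (w / s) `^ ga).
  by rewrite !powRD ?sn ?implybT//; ring.
rewrite abg powRr1// ler_piMr//.
apply: (@le_trans _ _ (expR (al * (u / s - 1)) * expR (be * (v / s - 1)) *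
    expR (ga * (w / s - 1)))).
  by rewrite !ler_pM ?mulr_ge0 ?powR_ge0 ?powR_le_expR ?divr_ge0.
rewrite -!expRD -[leRHS]expR0 ler_expR le_eqVlt; apply/orP; left; apply/eqP.
have -> : al * (u / s - 1) + be * (v / s - 1) + ga * (w / s - 1) = s / s - (al + be + ga).
  by rewrite {4}/s; field.
by rewrite abg divff// subrr.
Qed.

(** The base may be 0: nonnegative exponents with sum 0 are both 0, and all powers are then 1. *)
Lemma powRD_ge0 (x r s : R) : 0 <= r -> 0 <= s -> x `^ (r + s) = x `^ r * x `^ s.
Proof.
move=> r0 s0; have [rs|rs] := eqVneq (r + s) 0; last by rewrite powRD ?(negbTE rs).
move: rs => /eqP; rewrite paddr_eq0// => /andP[/eqP -> /eqP ->].
by rewrite addr0 powRr0 mulr1.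
Qed.

(* A trilinear Young inequality. The l_{1/e}-ball is described by sequences
   dominated by U^e with U in the l_1-ball, which covers e = 0 (0^0 = 1). *)
Lemma trilinear_young (I K L : finType) (c : I -> K -> L -> R)
    (w U : I -> R) (x X : K -> R) (y Y : L -> R) (al be ga B : R) :
  (forall i k l, 0 <= c i k l) ->
  (forall i k, \sum_l c i k l <= 1) ->
  (forall i l, \sum_k c i k l <= 1) ->
  (forall k l, \sum_i c i k l <= 1) ->
  0 <= al -> 0 <= be -> 0 <= ga -> al + be + ga = 1 -> 0 <= B ->
  (forall i, 0 <= w i <= B * U i `^ (al + be)) ->
  (forall k, 0 <= x k <= X k `^ (al + ga)) ->
  (forall l, 0 <= y l <= Y l `^ (be + ga)) ->
  (forall i, 0 <= U i) -> (forall k, 0 <= X k) -> (forall l, 0 <= Y l) ->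
  \sum_i U i <= 1 -> \sum_k X k <= 1 -> \sum_l Y l <= 1 ->
  \sum_i \sum_k \sum_l w i * x k * y l * c i k l <= B.
Proof.
move=> c0 cl ck ci al0 be0 ga0 abg B0 wU xX yY U0 X0 Y0 U1 X1 Y1.
(* The product of powers regroups as (U X)^al (U Y)^be (X Y)^ga, to which weighted AM-GM applies.
   Each term of [t] omits one of U, X, Y, and [c] sums to at most 1 over the omitted index. *)
pose t i k l := al * (U i * X k * c i k l) + be * (U i * Y l * c i k l)
  + ga * (X k * Y l * c i k l).
apply: (@le_trans _ _ (\sum_i \sum_k \sum_l B * t i k l)).
  apply: ler_sum => i _; apply: ler_sum => k _; apply: ler_sum => l _.
  have /andP[w0 wi] := wU i; have /andP[x0 xk] := xX k; have /andP[y0 yl] := yY l.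
  have -> : B * t i k l = B * (al * (U i * X k) + be * (U i * Y l) + ga * (X k * Y l)) * c i k l.
    by rewrite /t; ring.
  rewrite ler_wpM2r//.
  apply: (@le_trans _ _ (B * U i `^ (al + be) * X k `^ (al + ga) * Y l `^ (be + ga))).
    by rewrite !ler_pM ?mulr_ge0.
  have -> : B * U i `^ (al + be) * X k `^ (al + ga) * Y l `^ (be + ga) =
      B * ((U i * X k) `^ al * (U i * Y l) `^ be * (X k * Y l) `^ ga).
    by rewrite !powRM// !powRD_ge0//; ring.
  by rewrite ler_wpM2l// weighted_AMGM3// mulr_ge0.
have prod1 (J J' : finType) (f : J -> R) (g : J' -> R) (h : J -> J' -> R) :
    (forall j, 0 <= f j) -> (forall j, 0 <= g j) -> \sum_j f j <= 1 -> \sum_j g j <= 1 ->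
    (forall j j', h j j' <= 1) -> \sum_j \sum_j' f j * g j' * h j j' <= 1.
  move=> f0 g0 f1 g1 h1; apply: le_trans f1; apply: ler_sum => j _.
  apply: (@le_trans _ _ (f j * \sum_j' g j')); last by rewrite ler_piMr.
  by rewrite mulr_sumr; apply: ler_sum => j' _; rewrite ler_piMr// mulr_ge0.
have UX : \sum_i \sum_k \sum_l U i * X k * c i k l <= 1.
  under eq_bigr do under eq_bigr do rewrite -mulr_sumr.
  exact: prod1.
have UY : \sum_i \sum_k \sum_l U i * Y l * c i k l <= 1.
  under eq_bigr do rewrite exchange_big/=.
  under eq_bigr do under eq_bigr do rewrite -mulr_sumr.
  exact: prod1.
have XY : \sum_i \sum_k \sum_l X k * Y l * c i k l <= 1.
  rewrite exchange_big/=; under eq_bigr do rewrite exchange_big/=.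
  under eq_bigr do under eq_bigr do rewrite -mulr_sumr.
  exact: prod1.
under eq_bigr do under eq_bigr do rewrite -mulr_sumr.
under eq_bigr do rewrite -mulr_sumr.
rewrite -mulr_sumr ler_piMr// -abg.
have -> : \sum_i \sum_k \sum_l t i k l =
   al * (\sum_i \sum_k \sum_l U i * X k * c i k l) +
   be * (\sum_i \sum_k \sum_l U i * Y l * c i k l) +
   ga * (\sum_i \sum_k \sum_l X k * Y l * c i k l).
  rewrite !mulr_sumr -!big_split; apply: eq_bigr => i _ /=.
  rewrite !mulr_sumr -!big_split; apply: eq_bigr => k _ /=.
  by rewrite !mulr_sumr -!big_split.
by rewrite !lerD// ler_piMr.
Qed.

(** Test against the norming sequence: Y = t^(1/e) / S sums to 1 and t = S^e Y^e, so t Y^(1-e) = S^e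
    Y sums to S^e. *)
Lemma lp_dual_bound (L : finType) (t : L -> R) (e B : R) : 0 <= B -> 0 < e <= 1 ->
  (forall l, 0 <= t l) ->
  (forall y Y : L -> R, (forall l, 0 <= Y l) -> \sum_l Y l <= 1 ->
     (forall l, 0 <= y l <= Y l `^ (1 - e)) -> \sum_l t l * y l <= B) ->
  (\sum_l t l `^ e^-1) `^ e <= B.
Proof.
move=> B0 /andP[e0 e1] t0 h; set S := \sum_l _.
have [->|Sn] := eqVneq S 0; first by rewrite powR0// gt_eqF.
have S0 : 0 <= S by rewrite sumr_ge0// => l _; exact: powR_ge0.
have Sp : 0 < S by rewrite lt_def Sn.
pose Y l := t l `^ e^-1 / S.
have Y0 l : 0 <= Y l by rewrite divr_ge0 ?powR_ge0.
have Y1 : \sum_l Y l = 1 by rewrite -mulr_suml divff.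
have yY l : 0 <= Y l `^ (1 - e) <= Y l `^ (1 - e) by rewrite powR_ge0 lexx.
have := h (fun l => Y l `^ (1 - e)) Y Y0; rewrite Y1 => /(_ (lexx _) yY).
apply: le_trans.
have -> : S `^ e = \sum_l S `^ e * Y l by rewrite -mulr_sumr Y1 mulr1.
rewrite le_eqVlt; apply/orP; left; apply/eqP; apply: eq_bigr => l _.
have pw : Y l = Y l `^ e * Y l `^ (1 - e).
  by rewrite -powRD_ge0 ?(ltW e0) ?subr_ge0// addrC subrK powRr1.
rewrite {1}pw mulrA; congr (_ * _).
by rewrite -powRM// mulrC divfK// -powRrM mulVf ?gt_eqF// powRr1.
Qed.
End Young.

(** * The map rho in singular coordinates *)

Section Rho.
Variable R : realType.
Local Notation C := R[i].

(** The form in which the unit ball of [norm_min] is used, free of suprema. *)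
Definition row_contr n m (W : 'I_m -> 'M[C]_n) :=
  forall v, \sum_i cabs2 (v i) = 1 -> contr (\sum_i v i *: W i).

Lemma norm_min_row_contr n m (W : 'I_m -> 'M[C]_n) : norm_min W <= 1 -> row_contr W.
Proof.
move=> W1 v v1; apply: opn_contr; apply: le_trans W1; apply: ub_le_sup; last by exists v.
(* A bound uniform in the unit vector [u], by Cauchy-Schwarz in each entry. *)
exists (Num.sqrt (\sum_(a : 'I_n) \sum_(b : 'I_n) \sum_i cabs2 (W i a b))) => _ [u /= u1 <-].
apply: opn_le => x; rewrite vnorm_le// expr1n => /(sqnorm_bound (\sum_i u i *: W i)) h.
rewrite ler_wsqrtr//; apply: le_trans h _.
apply: ler_sum => a _; apply: ler_sum => b _; rewrite summxE.
under [X in cabs2 X]eq_bigr do rewrite mxE.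
by apply: cabs2_sum_le; rewrite u1.
Qed.

(** Rotating the family rotates the coefficients [v], and [V] preserves their norm. *)
Lemma row_contr_rot n m (W : 'I_m -> 'M[C]_n) (V : 'M[C]_m) : isom_mx V ->
  row_contr W -> row_contr (fun l => \sum_j (V j l)^* *: W j).
Proof.
move=> VV cW v v1.
have -> : \sum_i v i *: (\sum_j (V j i)^* *: W j) = \sum_j (\sum_i v i * (V j i)^*) *: W j.
  under eq_bigr do rewrite scaler_sumr; rewrite exchange_big.
  by apply: eq_bigr => j _; rewrite scaler_suml; apply: eq_bigr => i _; rewrite scalerA.
apply: cW.
have := sqnorm_isom (\col_i (v i)^*) VV.
rewrite /sqnorm; under [RHS]eq_bigr do rewrite mxE cabs2J.
rewrite v1 => <-; apply: eq_bigr => j _; rewrite -cabs2J rmorph_sum mxE; congr cabs2.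
by apply: eq_bigr => i _; rewrite rmorphM /= conjCK mxE mulrC.
Qed.

Lemma row_contr_contr n m (W : 'I_m -> 'M[C]_n) i : row_contr W -> contr (W i).
Proof.
move=> /(_ (fun j => (j == i)%:R)).
rewrite (bigD1 i)//= big1 => [|j /negbTE ->]; last by rewrite cabs2_real expr0n.
rewrite (bigD1 i)//= big1 => [|j /negbTE ->]; last by rewrite scale0r.
by rewrite eqxx scale1r !addr0 cabs2_real expr1n; apply.
Qed.

(** Take [v] proportional to the conjugates of the entries [tau i]: the (l, k) entry of A (sum_i v_i
    W_i) B is then the square root of [S], and it is an entry of a contraction. *)
Lemma row_contr_entries n m (W : 'I_m -> 'M[C]_n) (A B : 'M[C]_n) l k :
  row_contr W -> contr A -> contr B ->
  \sum_i cabs2 ((A *m W i *m B) l k) <= 1.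
Proof.
move=> cW cA cB; pose tau i := (A *m W i *m B) l k; set S := \sum_i _.
have S0 : 0 <= S by rewrite sumr_ge0// => i _; exact: cabs2_ge0.
have [->//|Sn] := eqVneq S 0; have Sp : 0 < S by rewrite lt_def Sn.
pose r := (Num.sqrt S)^-1.
have rS : r ^+ 2 * S = 1 by rewrite exprVn sqr_sqrtr// mulVf.
pose v i := r%:C * (tau i)^*.
have : \sum_i cabs2 (v i) = 1.
  by rewrite -rS mulr_sumr; apply: eq_bigr => i _; rewrite cabs2M cabs2_real cabs2J.
move=> /cW cv; have := contr_entry l k (contrM (contrM cA cv) cB).
have -> : (A *m (\sum_i v i *: W i) *m B) l k = (r * S)%:C.
  rewrite mulmx_sumr mulmx_suml summxE rmorphM rmorph_sum mulr_sumr.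
  by apply: eq_bigr => i _; rewrite -scalemxAr -scalemxAl mxE -mulrA [_^* * _]mulrC mulCJ.
have -> : cabs2 (r * S)%:C = r ^+ 2 * S * S by rewrite cabs2_real; ring.
by rewrite rS mul1r.
Qed.

(** With Z = B V the truncated family is sum_l Z_(i,l) W_l. Summing over i leaves entries of Z^* Z,
    which is diagonal, so the cross terms vanish. *)
Lemma rho_applyT N m n (a : nat -> nat -> C) (T : 'I_m -> 'M[C]_n) x :
  let B := \matrix_(i < N, j < m) a i j in
  forall (V : 'M[C]_m) (s : 'I_m -> R), isom_mx V ->
  (B *m V)^t* *m (B *m V) = real_diag (fun j => s j ^+ 2) ->
  let W l := \sum_j (V j l)^* *: T j in
  rho (@applyT _ n m a T N) x = \sum_l (s l ^+ 2)%:C *: (W l *m x *m (W l)^t*).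
Proof.
move=> B V s VV gr W; pose Z := B *m V.
have TE i : applyT a T i = \sum_l Z i l *: W l.
  have BE : B = Z *m V^t* by rewrite -mulmxA isom_ctK// mulmx1.
  rewrite /applyT /W; under [RHS]eq_bigr do rewrite scaler_sumr.
  rewrite exchange_big; apply: eq_bigr => j _.
  have := BE; rewrite -matrixP => /(_ i j); rewrite mxE => ->.
  rewrite mxE scaler_suml; apply: eq_bigr => l _; by rewrite scalerA !mxE.
rewrite /rho.
under eq_bigr do rewrite TE adjE.
transitivity (\sum_(i < N) \sum_l \sum_l' (Z i l * (Z i l')^*) *: (W l *m x *m (W l')^t*)).
  apply: eq_bigr => i _; rewrite !mulmx_suml; apply: eq_bigr => l _.
  rewrite ct_sum mulmx_sumr; apply: eq_bigr => l' _.
  by rewrite ctZ -!scalemxAl -scalemxAr scalerA.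
rewrite exchange_big; apply: eq_bigr => l _; rewrite exchange_big /=.
under eq_bigr do rewrite -scaler_suml.
have Zg l' : \sum_i Z i l * (Z i l')^* = if l' == l then (s l ^+ 2)%:C else 0.
  transitivity ((Z^t* *m Z) l' l).
    by rewrite mxE; apply: eq_bigr => i _; rewrite mulrC !mxE.
  by rewrite gr !mxE; case: eqVneq => [->|_]; rewrite ?mulr1n ?mulr0n.
under eq_bigr do rewrite Zg.
rewrite (bigD1 l)//= eqxx big1 ?addr0// => l' /negbTE ->.
by rewrite scale0r.
Qed.

(** The singular value is the diagonal entry (H^* y G)_(l,l). Inserting the decomposition of [x]
    turns it into the sum of lam_i d_k times M_i(l,k) and the conjugate of P_i(l,k), whose real part
    is at most the mean of the two squared moduli. *)
Lemma sing_rho_le m n (W : 'I_m -> 'M[C]_n) (lam : 'I_m -> R) (x : 'M[C]_n) :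
  row_contr W -> (forall i, 0 <= lam i) ->
  exists c : 'I_m -> 'I_n -> 'I_n -> R,
  [/\ forall i k l, 0 <= c i k l,
      forall i k, \sum_l c i k l <= 1,
      forall i l, \sum_k c i k l <= 1,
      forall k l, \sum_i c i k l <= 1 &
      forall l : 'I_n, sing l (\sum_i (lam i)%:C *: (W i *m x *m (W i)^t*)) <=
        \sum_i \sum_(k < n) lam i * sing k x * c i k l].
Proof.
move=> cW lam0; set y := \sum_i _.
have [E [F [d [cE FF xE _ dE]]]] := svd x.
have [H [G [t [cH GG _ tE tS]]]] := svd y.
pose M i := H^t* *m W i *m E; pose P i := G^t* *m W i *m F.
have cH' := contr_ct cH; have cG' := contr_ct (isom_contr GG).
have cF := isom_contr FF.
have cM i : contr (M i) := contrM (contrM cH' (row_contr_contr i cW)) cE.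
have cP i : contr (P i) := contrM (contrM cG' (row_contr_contr i cW)) cF.
have half (J : finType) (f g : J -> R) : \sum_j f j <= 1 -> \sum_j g j <= 1 ->
    \sum_j (f j + g j) / 2 <= 1.
  by move=> f1 g1; rewrite -mulr_suml big_split/= ler_pdivrMr// mul1r lerD.
exists (fun i k l => (cabs2 (M i l k) + cabs2 (P i l k)) / 2); split.
- by move=> i k l; rewrite divr_ge0// addr_ge0// cabs2_ge0.
- by move=> i k; exact: half (contr_col k (cM i)) (contr_col k (cP i)).
- by move=> i l; exact: half (contr_row l (cM i)) (contr_row l (cP i)).
- by move=> k l; apply: half; exact: row_contr_entries.
move=> l; have [_ <-] := tS l.
have -> : t l = complex.Re ((H^t* *m (y *m G)) l l) by rewrite tE.
have -> : H^t* *m (y *m G) = \sum_i (lam i)%:C *: (M i *m real_diag d *m (P i)^t*).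
  rewrite /y mulmx_suml mulmx_sumr; apply: eq_bigr => i _.
  rewrite -scalemxAl -scalemxAr {1}xE /M /P !ctM !trmxCK !mulmxA.
  reflexivity.
rewrite summxE Re_sum; apply: ler_sum => i _.
rewrite mxE.
have -> : complex.Re ((lam i)%:C * (M i *m real_diag d *m (P i)^t*) l l) =
    lam i * complex.Re ((M i *m real_diag d *m (P i)^t*) l l) by exact: Re_realM.
rewrite mxE Re_sum mulr_sumr; apply: ler_sum => k _.
have [d0 <-] := dE k.
have -> : complex.Re ((M i *m real_diag d) l k * ((P i)^t*) k l) =
    d k * complex.Re (M i l k * (P i l k)^*).
  rewrite mul_real_diag -mulrA [((P i)^t*) k l]mxE [((P i)^T) k l]mxE.
  exact: Re_realM.
rewrite mulrA ler_wpM2l ?mulr_ge0//.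
exact: Re_mulJ_le.
Qed.
End Rho.

(** * Schatten norms, the bound for one truncation, and approximation numbers *)

Section Exponents.
Variable R : realType.
Local Notation C := R[i].

Lemma einv_bound (p : \bar R) : (1 <= p)%E -> 0 <= einv p <= 1.
Proof.
case: p => [x| |]//=; last by rewrite lexx ler01.
rewrite lee_fin => x1; have x0 : 0 < x by apply: lt_le_trans x1.
by rewrite invr_ge0 (ltW x0) invf_le1.
Qed.

Lemma einv_anti (p q : \bar R) : (1 <= p)%E -> (p <= q)%E -> einv q <= einv p.
Proof.
case: p q => [x| |] [y| |]//=; rewrite ?lee_fin => x1 xy.
  have x0 : 0 < x by apply: lt_le_trans x1.
  by rewrite lef_pV2// posrE (lt_le_trans x0).
by rewrite invr_ge0 (le_trans ler01).
Qed.

(** Puts the ball in the form used by [trilinear_young]: X = s^p for finite p, and X = 0 for p = oo,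
    where 0^0 = 1. *)
Lemma schatten_ball (p : \bar R) n (x : 'M[C]_n) : (1 <= p)%E -> schatten p x <= 1 ->
  exists X : 'I_n -> R, [/\ forall k, 0 <= X k, \sum_k X k <= 1 &
    forall k : 'I_n, sing k x <= X k `^ einv p].
Proof.
case: p => [r| |]//=.
- rewrite lee_fin => r1; have r0 : 0 < r by apply: lt_le_trans r1.
  move=> S1; exists (fun k : 'I_n => sing k x `^ r); split.
  + by move=> k; exact: powR_ge0.
  + set S := \sum_k _ in S1 *.
    have S0 : 0 <= S by rewrite sumr_ge0// => k _; exact: powR_ge0.
    rewrite -(powRr1 S0) -(mulVf (lt0r_neq0 r0)) powRrM.
    apply: le_trans (ge0_ler_powR (ltW r0) _ _ S1) _; rewrite ?nnegrE ?powR_ge0//.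
    by rewrite powR1 mulVf ?gt_eqF.
  + by move=> k; rewrite -powRrM divff ?gt_eqF// powRr1// sing_ge0.
- move=> _ x1; exists (fun=> 0); split=> //; first by rewrite big1 ?ler01.
  move=> k; rewrite powRr0; by apply: le_trans x1; exact: sing_le_opn.
Qed.

(** For finite q this is [lp_dual_bound] with e = 1/q. For q = oo, testing against the indicator of
    [l] bounds each singular value separately. *)
Lemma schatten_dual_le (q : \bar R) n (x : 'M[C]_n) (B : R) : (1 <= q)%E -> 0 <= B ->
  (forall y Y : 'I_n -> R, (forall l, 0 <= Y l) -> \sum_l Y l <= 1 ->
     (forall l, 0 <= y l <= Y l `^ (1 - einv q)) -> \sum_(l < n) sing l x * y l <= B) ->
  schatten q x <= B.
Proof.
case: q => [r| |]//=.
- rewrite lee_fin => r1 B0 h; have r0 : 0 < r by apply: lt_le_trans r1.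
  rewrite -{1}(invrK r); apply: (lp_dual_bound (t := fun l : 'I_n => sing l x)) => //.
    by rewrite invr_gt0 r0 invf_le1.
  by move=> l; exact: sing_ge0.
- move=> _ B0 h; have [E [V [s [cE VV xE _ sE]]]] := svd x.
  apply: (opn_factor B0 _ cE VV xE) => l; have [s0 ss] := sE l.
  rewrite ger0_norm// ss; pose y j : R := (j == l)%:R.
  have y1 : \sum_j y j = 1.
    by rewrite (bigD1 l)//= big1 ?addr0 /y ?eqxx// => j /negbTE ->.
  have := h y y; rewrite y1 subr0.
  rewrite (bigD1 l)//= big1 ?addr0 => [|j /negbTE jl]; last by rewrite /y jl mulr0.
  by rewrite /y eqxx mulr1; apply=> // j; rewrite ?ler0n ?powRr1 ?ler0n ?lexx.
Qed.

(** [U] witnesses that s^2 / K^2 lies in the unit ball of l_(r/2), with r = oo included through the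
    exponent 0. *)
Lemma norm_pq_le (p q : \bar R) N m n (a : nat -> nat -> C) (T : 'I_m -> 'M[C]_n)
    (V : 'M[C]_m) (s U : 'I_m -> R) (K : R) :
  (1 <= p)%E -> (p <= q)%E -> norm_min T <= 1 -> isom_mx V ->
  let B := \matrix_(i < N, j < m) a i j in
  (B *m V)^t* *m (B *m V) = real_diag (fun j => s j ^+ 2) ->
  0 <= K -> (forall i, 0 <= U i) -> \sum_i U i <= 1 ->
  (forall i, s i ^+ 2 <= K ^+ 2 * U i `^ (einv q - einv p + 1)) ->
  norm_pq p q (@applyT _ n m a T N) <= K.
Proof.
move=> p1 pq T1 VV B gr K0 U0 U1 sU.
have q1 : (1 <= q)%E by exact: le_trans pq.
have /andP[ep0 ep1] := einv_bound p1; have /andP[eq0 eq1] := einv_bound q1.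
have epq := einv_anti p1 pq.
rewrite /norm_pq -[leRHS]ger0_norm// -sqrtr_sqr ler_wsqrtr//.
apply: ge_sup => [|_ [x /= x1 <-]].
  exists (schatten q (rho (@applyT _ n m a T N) 0)), 0 => //=.
  apply: schatten_dual_le => // y Y _ _ _; rewrite big1// => l _.
  suff -> : sing l (0 : 'M[C]_n) = 0 by rewrite mul0r.
  apply/le_anti; rewrite sing_ge0 andbT; apply: le_trans (sing_le_opn _ _) _.
  by apply: opn_le => z _; rewrite mul0mx vnormE sqnorm0 sqrtr0.
have [X [X0 X1 xX]] := schatten_ball p1 x1.
apply: schatten_dual_le; rewrite ?sqr_ge0// => y Y Y0 Y1 yY.
rewrite (rho_applyT T x VV gr).
have cW := row_contr_rot VV (norm_min_row_contr T1).
have [c [c0 cl ck ci sc]] := sing_rho_le (lam := fun i => s i ^+ 2) x cW (fun i => sqr_ge0 _).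
apply: (@le_trans _ _
  (\sum_i \sum_(k < n) \sum_l s i ^+ 2 * sing k x * y l * c i k l)).
  under [leRHS]eq_bigr do rewrite exchange_big.
  rewrite exchange_big; apply: ler_sum => l _ /=.
  have /andP[y0 _] := yY l.
  apply: le_trans (ler_wpM2r y0 (sc l)) _; rewrite mulr_suml.
  apply: ler_sum => i _; rewrite mulr_suml; apply: ler_sum => k _.
  by rewrite mulrAC.
(* The pairwise sums are 2/r for s^2, 1/p for x and 1 - 1/q for y. Nonnegativity of [ga] is where p
   <= q enters. *)
apply: (trilinear_young (al := einv q) (be := 1 - einv p) (ga := einv p - einv q)
  (U := U) (X := X) (Y := Y)); rewrite ?subr_ge0 ?sqr_ge0 //.
- by ring.
- move=> i; rewrite sqr_ge0 /=; apply: le_trans (sU i) _.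
  by rewrite addrA addrAC.
- by move=> k; rewrite sing_ge0 /= addrC subrK.
- by move=> l; have := yY l; rewrite addrA subrK.
Qed.

(** A corner of a rank-l competitor f has rank at most l, so it kills a unit vector on which B has
    norm at least [s l]; that vector tests the norm of a - f. *)
Lemma approx_ge N m (a : nat -> nat -> C) (V : 'M[C]_m) (s : 'I_m -> R) (l : 'I_m) :
  let B := \matrix_(i < N, j < m) a i j in
  isom_mx V -> (forall j, 0 <= s j) -> (forall k l : 'I_m, (k <= l)%N -> s l <= s k) ->
  (B *m V)^t* *m (B *m V) = real_diag (fun j => s j ^+ 2) ->
  ((s l)%:E <= Defs.approx l a)%E.
Proof.
move=> B VV s0 sle gr; apply: le_ereal_inf_tmp => _ [f [[u [v fuv]] ->]].
pose F := \matrix_(i < N, j < m) f i j.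
have FE : F = (\matrix_(i < N, k < l) u k i) *m (\matrix_(k < l, j < m) v k j).
  by apply/matrixP => i j; rewrite !mxE fuv; apply: eq_bigr => k _; rewrite !mxE.
have rF : (\rank F <= l)%N.
  by rewrite FE (leq_trans (mxrankM_maxl _ _))// rank_leq_col.
have [x [x1 Fx sx]] := rank_kernel_vector VV s0 sle gr rF.
apply: le_trans (ereal_sup_ubound _); first by rewrite -lee_fin in sx; exact: sx.
exists N, m, x; split; first by rewrite vnorm_le// x1 expr1n.
rewrite -[B *m x]subr0 -Fx -mulmxBl; congr (vnorm _)%:E.
apply/matrixP => i j; rewrite !mxE ord1; apply: eq_bigr => k _.
by rewrite !mxE.
Qed.

Lemma approx_le_opnormA k (a : nat -> nat -> C) : (Defs.approx k a <= opnormA a)%E.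
Proof.
apply: ereal_inf_lbound; exists (fun _ _ => 0); split.
  by exists (fun _ _ => 0), (fun _ _ => 0) => i j; rewrite big1// => l _; rewrite mul0r.
by congr opnormA; apply/funext => i; apply/funext => j; rewrite subr0.
Qed.

Lemma opnormA_ge0 (a : nat -> nat -> C) : (0 <= opnormA a)%E.
Proof.
apply: ereal_sup_ubound; exists 0%N, 0%N, 0.
have v0 : vnorm (0 : 'cV[C]_0) = 0 by rewrite vnormE sqnorm0 sqrtr0.
rewrite v0; split=> //; congr (_%:E); rewrite -v0; congr vnorm.
by apply/matrixP => -[].
Qed.

Lemma approx_ge0 k (a : nat -> nat -> C) : (0 <= Defs.approx k a)%E.
Proof. by apply: le_ereal_inf_tmp => _ [f [_ ->]]; exact: opnormA_ge0. Qed.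
End Exponents.

Unset Implicit Arguments.

Theorem theorem4p4 (R : realType) (p q : \bar R) :
  (1 <= p)%E -> (p <= q)%E ->
  forall a : nat -> nat -> R[i],
    (cbnorm p q a <= schattenA (rexp p q) a)%E.
Proof.
move=> p1 pq a; apply: ge_ereal_sup => _ [n [m [T [T1 ->]]]].
apply: ge_ereal_sup => _ [N _ <-].
have [V [s [VV s0 sle gr]]] := gram_diag (\matrix_(i < N, j < m) a i j).
have sa l := approx_ge l VV s0 sle gr.
rewrite /rexp; set D := einv q - einv p + 1.
have D0 : 0 <= D.
  have /andP[_ ep1] := einv_bound p1; have /andP[eq0 _] := einv_bound (le_trans p1 pq).
  by rewrite /D; lra.
have bound := norm_pq_le p1 pq T1 VV gr; rewrite -/D in bound.
(* D = 0 means p = 1 and q = oo, so r = oo. With K the operator norm of [a], U = 0 works since 0^0 =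
   1. *)
have [DE|Dn] := eqVneq D 0.
  rewrite /schattenA.
  have {}sa l : ((s l)%:E <= opnormA a)%E by exact: le_trans (approx_le_opnormA _ _).
  case: (opnormA a) (opnormA_ge0 a) sa => [K K0 sK|_ _|]; [|exact: leey|by []].
  rewrite !lee_fin in K0 *; apply: (bound (fun=> 0)) => //; first by rewrite big1 ?ler01.
  by move=> i; rewrite DE powRr0 mulr1 lerXn2r ?nnegrE//; have := sK i; rewrite lee_fin.
have Dp : 0 < D by rewrite lt_def Dn.
set r := 2 / D; have r0 : 0 < r by rewrite divr_gt0.
rewrite /schattenA; set W := \sum_(l < m) s l `^ r.
have W0 : 0 <= W by rewrite sumr_ge0// => l _; exact: powR_ge0.
(* W^(1/r) is the l_r norm of the singular values of the truncation. They are dominated termwise by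
   the approximation numbers of [a], and the rest of the series is nonnegative. *)
apply: (@le_trans _ _ (poweR W%:E r^-1)); last first.
  apply: gt0_ler_poweR; rewrite ?invr_ge0 ?(ltW r0)//.
  - by rewrite in_itv /= leey lee_fin W0.
  - rewrite in_itv /= leey andbT; apply: nneseries_ge0 => k _ _; exact: poweR_ge0.
  apply: le_trans (nneseries_lim_ge m _); last by move=> k _ _; exact: poweR_ge0.
  rewrite big_mkord /W -sumEFin; apply: lee_sum => l _; rewrite -poweR_EFin.
  by apply: gt0_ler_poweR; rewrite ?(ltW r0)// in_itv /= leey ?lee_fin ?s0 ?approx_ge0.
(* Here K = W^(1/r) and U = s^r / W; as r D = 2, K^2 U^D equals s^2 when W is nonzero. *)
rewrite poweR_EFin lee_fin; apply: (bound (fun l => s l `^ r / W)).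
- exact: powR_ge0.
- by move=> i; rewrite divr_ge0 ?powR_ge0.
- rewrite -mulr_suml -/W; have [->|Wn] := eqVneq W 0; first by rewrite mul0r.
  by rewrite divff.
move=> i; have rD : r * D = 2 by rewrite /r divfK.
have sr : (s i `^ r) `^ D = s i ^+ 2 by rewrite -powRrM rD powR_mulrn.
(* If W = 0, every s_i^r is 0, hence so is s_i^2 = (s_i^r)^D because D > 0. *)
have [WE|Wn] := eqVneq W 0.
  have : s i `^ r <= W by rewrite /W (bigD1 i)//= lerDl sumr_ge0// => l _; exact: powR_ge0.
  rewrite WE => h; have si : s i `^ r = 0 by apply/le_anti; rewrite h powR_ge0.
  by rewrite -sr si powR0// mulr_ge0 ?sqr_ge0 ?powR_ge0.
have KW : (W `^ r^-1) ^+ 2 = W `^ D.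
  by rewrite -powR_mulrn ?powR_ge0// -powRrM -rD mulrA mulVf ?gt_eqF// mul1r.
by rewrite KW -powRM ?divr_ge0 ?powR_ge0// mulrC divfK// sr.
Qed.
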